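(* Let $G$ be a group, let $\mu$ be an $L$-subgroup of $G$, let $\eta \in L(\mu)$ and let $a_z$ be an $L$-point of $\mu$ (with $a\in L$, $z\in G$). Then the $L$-subset $\eta^{a_z}$ of $G$ given by $\eta^{a_z}(x) = a \wedge \eta(zxz^{-1})$ for all $x\in G$ is an $L$-subgroup of $\mu$.
   Context: $L=\langle L,\le,\vee,\wedge\rangle$ is a completely distributive (complete) lattice with greatest element $1$ and least element $0$. $G$ is an ordinary group with identity $e$. An $L$-subset of $G$ is a function $G\to L$; for $L$-subsets, $\eta\subseteq\mu$ means $\eta(x)\le\mu(x)$ for all $x\in G$. An $L$-subset $\mu$ of $G$ is an $L$-subgroup of $G$ if $\mu(xy)\ge\mu(x)\wedge\mu(y)$ and $\mu(x^{-1})=\mu(x)$ for all $x,y\in G$; $L(G)$ is the set of $L$-subgroups of $G$. For $\mu\in L(G)$, an $L$-subgroup of $\mu$ is an $\eta\in L(G)$ with $\eta\subseteq\mu$; $L(\mu)$ is the set of $L$-subgroups of $\mu$. For $a\in L$ and $z\in G$, the $L$-point $a_z$ is the $L$-subset with value $a$ at $z$ and $0$ elsewhere; it is an $L$-point of $\mu$ (written $a_z\in\mu$) if $\mu(z)\ge a$. The $L$-subset $\eta^{a_z}$ is called the conjugate of $\eta$ by $a_z$. *)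

(* Defs.v *)
From mathcomp Require Import all_boot all_order.
From mathcomp Require Import boolp classical_sets.

Set Implicit Arguments.
Unset Strict Implicit.
Unset Printing Implicit Defensive.

Import Order.TTheory.

Local Open Scope classical_set_scope.
Local Open Scope order_scope.

Definition complete_lattice d (L : tbLatticeType d) : Prop :=
  forall A : set L, supremums A !=set0 /\ infimums A !=set0.

(* The default values make the join and the meet of the empty set right. *)
Lemma complete_latticeE d (L : tbLatticeType d) (A : set L) :
  complete_lattice L ->
  supremums A (supremum \bot A) /\ infimums A (infimum \top A).
Proof.
move=> /(_ A)[[s hs] [i hi]]; rewrite /supremum /infimum.
case: ifPn => [/eqP ->|_].
  by split; split=> // x _ /=; rewrite ?le0x ?lex1.
by split; case: xgetP => // /(_ _ _) h; [case: (h _ hs)|case: (h _ hi)].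
Qed.

Definition completely_distributive d (L : tbLatticeType d) : Prop :=
  complete_lattice L /\
  forall (I : Type) (J : I -> set L),
    infimum \top [set supremum \bot (J i) | i in [set: I]] =
    supremum \bot [set infimum \top (range f) |
                   f in [set f : I -> L | forall i, J i (f i)]].

Section Lsubsets.
Context d (L : tbLatticeType d) (G : groupType).
Implicit Types (eta mu : G -> L) (a : L) (z : G).

Definition Lsubset eta mu : Prop := forall x, eta x <= mu x.

Definition Lsubgroup mu : Prop :=
  (forall x y, mu x `&` mu y <= mu (x * y)%g) /\
  (forall x, mu x^-1%g = mu x).

Definition Lsubgroup_of mu eta : Prop := Lsubgroup eta /\ Lsubset eta mu.

Definition Lpoint a z : G -> L := fun x => if x == z then a else \bot.

(* The pair (a, z) is kept explicit because it cannot be recovered from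
   [Lpoint a z] when a = \bot. *)
Definition Lpoint_of mu a z : Prop := a <= mu z.

Lemma Lpoint_ofE mu a z : Lpoint_of mu a z <-> Lsubset (Lpoint a z) mu.
Proof.
split=> [h x|/(_ z)]; last by rewrite /Lpoint eqxx.
by rewrite /Lpoint; case: eqP => [->|_]; rewrite ?le0x.
Qed.

Definition Lconj eta a z : G -> L := fun x => a `&` eta (z * x * z^-1)%g.

End Lsubsets.

(* Main.v *)
Require Import Defs.
From mathcomp Require Import all_boot all_order.

Import Order.TTheory.

(** Conjugation by [z] is an endomorphism of [G], and meets with the constant [a] merge by
    idempotence, so the subgroup laws pass from [eta] to its conjugate. For containment in [mu],
    undoing the conjugation costs a factor [mu z] ([Lsubgroup_conj_ge]), and [a] pays for it since
    [a <= mu z]. *)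

Lemma Lsubgroup_conj_ge {d : Order.disp_t} {L : tbLatticeType d} {G : groupType}
    {mu : G -> L} (z x : G) :
  Lsubgroup mu -> (mu z `&` mu (z * x * z^-1)%g <= mu x)%O.
Proof.
move=> [muM muV].
have {2}-> : x = (z^-1 * (z * x * z^-1) * z)%g by rewrite -!mulgA mulVg mulg1 mulKg.
(* The outer factors [z^-1] and [z] both have [mu]-value [mu z], so a single [mu z] in the meet
   serves for both. *)
apply: le_trans (muM _ _); rewrite lexI leIl andbT.
by apply: le_trans (muM _ _); rewrite muV.
Qed.

Theorem theorem3p2 (d : Order.disp_t) (L : tbLatticeType d)
    (hL : completely_distributive L) (G : groupType) (mu eta : G -> L)
    (hmu : Lsubgroup mu) (heta : Lsubgroup_of mu eta)
    (a : L) (z : G) (haz : Lpoint_of mu a z) :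
  Lsubgroup_of mu (Lconj eta a z).
Proof.
case: heta => -[etaM etaV] eta_mu; rewrite /Lconj; split; first split.
- move=> x y; rewrite meetACA meetxx leI2 //.
  have -> : (z * (x * y) * z^-1 = (z * x * z^-1) * (z * y * z^-1))%g.
    by rewrite -!mulgA mulKg.
  exact: etaM.
(* [z * x^-1 * z^-1] is the inverse of [z * x * z^-1]. *)
- by move=> x; rewrite -(etaV (z * x * z^-1)%g) !invgM invgK mulgA.
- move=> x; apply: le_trans (Lsubgroup_conj_ge z x hmu).
  exact: leI2 haz (eta_mu _).
Qed.
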